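(* Let $\alpha>0$. There is a constant $C>0$, depending only on $\alpha$, such that for any polynomial $P$ (with complex coefficients) of degree $n$ and any subset $Z\subset D_1$ with $c_{h_\alpha}(Z)>0$, $$\sup_{z\in D_1}|P(z)|\le 12^n\exp\Big\{\frac{Cn^2(\log(n+e))^{-\frac{2\alpha}3}}{c_{h_\alpha}^2(Z)}\Big\}\sup_{z\in Z}|P(z)|.$$
   Context: $D_1=\{z\in\mathbb C:|z|\le1\}$; $c^2_{h_\alpha}(Z)=(c_{h_\alpha}(Z))^2$. A gauge function is a strictly increasing continuous $f:(0,\infty)\to[0,\infty)$ with $\lim_{t\to0^+}f(t)=0$. For a gauge function $f$ and $E\subset\mathbb C\cong\mathbb R^2$, the $f$-Hausdorff content is $c_f(E)=\inf\{\sum_{j\ge1} f(d(B_j)):E\subset\bigcup_{j\ge1} B_j\}$, where the $B_j$ are open balls (discs) with diameter $d(B_j)$. $h_\alpha(t)=(\log\frac1t)^{-1/2}(\log\log\frac1t)^{-\alpha}$ for $0<t\le e^{-3}$, understood as a gauge function on $(0,\infty)$ via a fixed extension with $h_\alpha(t)\sim1$ as $t\to+\infty$. *)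

(* Defs.v *)
From HB Require Import structures.
From mathcomp Require Import all_boot all_order all_algebra.
From mathcomp Require Import complex.
From mathcomp Require Import all_classical all_reals all_analysis.

Set Implicit Arguments.
Unset Strict Implicit.
Unset Printing Implicit Defensive.

Import Order.TTheory GRing.Theory Num.Theory.
Import numFieldNormedType.Exports.

Local Open Scope classical_set_scope.
Local Open Scope ring_scope.
Local Open Scope complex_scope.

(* [Normc.normc] is the modulus of a complex number as an element of [R]; the
   generic norm [`|z|] has values in [R[i]]. *)

Definition open_disc (R : realType) (c : R[i]) (r : R) : set R[i] :=
  [set z | Normc.normc (z - c) < r].

Definition closed_unit_disc (R : realType) : set R[i] :=
  [set z | Normc.normc z <= 1].

(* A gauge function lives on (0, oo): its values at t <= 0 are irrelevant. *)
Definition gauge_function (R : realType) (f : R -> R) : Prop :=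
  [/\ forall t, 0 < t -> 0 <= f t,
      forall s t, 0 < s -> s < t -> f s < f t,
      forall t, 0 < t -> {for t, continuous f}
    & f t @[t --> 0^'+] --> (0 : R)].

Definition hausdorff_content (R : realType) (f : R -> R) (E : set R[i])
    : \bar R :=
  ereal_inf [set s : \bar R | exists (c : nat -> R[i]) (r : nat -> R),
    [/\ forall j, 0 < r j,
        E `<=` \bigcup_j open_disc (c j) (r j)
      & s = (\sum_(0 <= j <oo) (f (2 * r j))%:E)%E]].

(* [h] is an admissible choice of the gauge function h_alpha: the explicit
   formula only makes sense for small t, and the extension to t > e^{-3} is
   constrained only by being a gauge function that tends to 1 at +oo. *)
Definition is_h_alpha (R : realType) (alpha : R) (h : R -> R) : Prop :=
  [/\ gauge_function h,
      forall t, 0 < t -> t <= expR (- 3) ->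
        h t = ln (1 / t) `^ (- (1 / 2)) * ln (ln (1 / t)) `^ (- alpha)
    & h t @[t --> +oo] --> (1 : R)].

(* Main.v *)
Require Import Defs.
From mathcomp Require Import all_boot all_order all_algebra.
From mathcomp Require Import complex.
From mathcomp Require Import all_classical all_reals all_analysis.
From mathcomp Require Import ring lra.

Import Order.TTheory GRing.Theory Num.Theory.
Import numFieldNormedType.Exports.

Local Open Scope classical_set_scope.
Local Open Scope ring_scope.
Local Open Scope complex_scope.

(* With [w_j] the roots of [P], the bound [3 |z - w_j| >= (1 + |w_j|) min(1, |z - w_j|)] on the unit disc
   reduces the claim to finding [z] in [Z] for which [prod_j min(1, |z - w_j|)] is not too small.
   Cartan's argument gives, for any increasing radii [r_k], exceptional discs outside of which fewer
   than [k] roots lie within distance [r_k] of [z], for every [k], so that the product is at least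
   [prod_k r_k].  The radii are [r_k = exp(- s_k) / 4] with [s_k = A M^2 L^(-2 alpha/3) k^(-3/2)],
   [M = 2 n / c(Z)] and [L = log(n + e)].  Then [h(4 r_k) <= k / M], so the exceptional discs have
   total gauge at most [n / M = c(Z) / 2] and cannot cover [Z], while [sum_k s_k <= 3 A M^2 L^(-2 alpha/3)]
   since [sum_k k^(-3/2) <= 3]. *)

(** * Modulus of complex numbers *)

Local Notation normc := Normc.normc.

Lemma normc_triangle (R : realType) (x y z : R[i]) :
  normc (x - z) <= normc (x - y) + normc (y - z).
Proof.
have := le_normcD ((x - y) : Rcomplex R) (y - z).
by rewrite addrA subrK.
Qed.

Lemma normc_ge0 (R : realType) (x : R[i]) : 0 <= normc x.
Proof. by case: x => a b /=; exact: sqrtr_ge0. Qed.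

Lemma normc_prod (R : realType) (I : Type) (s : seq I) (F : I -> R[i]) :
  normc (\prod_(i <- s) F i) = \prod_(i <- s) normc (F i).
Proof.
elim: s => [|i s IHs]; first by rewrite !big_nil Normc.normc1.
by rewrite !big_cons Normc.normcM IHs.
Qed.

(** * Cartan's argument for arbitrary increasing radii *)

(** Induction on the size: the count at the last index yields an entry at least the last radius, and
    removing it preserves the other count bounds. *)
Lemma prod_ge_of_count (R : realDomainType) (r : nat -> R) (s : seq R) :
  (forall k, 0 <= r k) ->
  (forall k, (k < size s)%N -> (count (fun x => x < r k)%R s <= k)%N) ->
  \prod_(k < size s) r k <= \prod_(x <- s) x.
Proof.
move=> r0; move Em : (size s) => m.
elim: m s Em => [|m IHm] s Es count_s.
  by rewrite big_ord0 (size0nil Es) big_nil.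
have [x xs rx] : exists2 x, x \in s & r m <= x.
  suff : has (fun x => ~~ (x < r m)) s.
    by case/hasP => x xs; rewrite -leNgt => ?; exists x.
  rewrite has_predC all_count Es neq_ltn ltnS.
  by rewrite (leq_trans (count_s m _)).
rewrite big_ord_recr /= (perm_big _ (perm_to_rem xs)) big_cons mulrC.
apply: ler_pM => //; first exact: prodr_ge0.
apply: IHm => [|k km]; first by rewrite size_rem // Es.
apply: leq_trans (count_s k (leqW km)).
exact: leq_count_subseq (rem_subseq _ _).
Qed.

(* A pair [(c, k)] in [l] stands for the disc of radius [2 r_k] around [c], and accounts for [k + 1]
   points of [s].  Greedy choice: the largest [k] such that some disc of radius [r_k] contains more
   than [k] points; discs of radius [r_j], [j <= k], centred at distance at least [2 r_k] miss it. *)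
Lemma cartan_exceptional_discs (R : realType) (r : nat -> R) (s : seq R[i]) :
  {homo r : i j / (i <= j)%N >-> i <= j} ->
  exists l : seq (R[i] * nat), (\sum_(p <- l) p.2.+1 <= size s)%N /\
    forall z, (forall p, p \in l -> 2 * r p.2 <= normc (z - p.1)) ->
    forall k, (count (fun w => normc (z - w) < r k)%R s <= k)%N.
Proof.
move=> r_mono; have [n] := ubnP (size s).
elim: n s => // n IHn s /ltnSE-sn.
pose P k := `[< exists c, k < count (fun w => normc (c - w) < r k)%R s >]%N.
have [exP|noP] := pselect (exists k, P k); last first.
  exists [::]; rewrite big_nil; split=> // z _ k.
  rewrite leqNgt; apply/negP => kz; apply: noP; exists k.
  by apply/asboolP; exists z.
have ubP k : P k -> (k <= size s)%N.
  by move=> /asboolP[c /ltnW/leq_trans]; apply; exact: count_size.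
case: (ex_maxnP exP ubP) => k /asboolP[c kc] kmax.
pose near_c w := normc (c - w) < r k.
have size_split : (count near_c s + size (seq.filter (predC near_c) s) = size s)%N.
  by rewrite size_filter count_predC.
have [|l [sum_l lP]] := IHn (seq.filter (predC near_c) s).
  by rewrite (leq_trans _ sn) // -size_split -add1n leq_add2r (leq_trans _ kc).
exists ((c, k) :: l); split.
  rewrite big_cons -size_split.
  exact: leq_add.
(* For [j > k], maximality of [k] bounds the count; for [j <= k], no removed point lies within [r j]
   of [z]. *)
move=> z zl j; case: (ltnP k j) => kj.
  rewrite leqNgt; apply/negP => jz.
  by move: (kmax j); rewrite leqNgt kj => /(_ _)/negP; apply; [apply/asboolP; exists z|].
have zl' p : p \in l -> 2 * r p.2 <= normc (z - p.1).
  by move=> pl; apply: zl; rewrite inE pl orbT.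
apply: leq_trans (lP z zl' j); rewrite count_filter.
apply: sub_count => w /= zw; rewrite zw /= /near_c -leNgt.
have /= zc := zl (c, k) (mem_head _ _).
have := @normc_triangle R z w c; rewrite -[normc (w - c)](normcN (w - c : Rcomplex R)) opprB.
have := r_mono _ _ kj; move: zw zc; clear; lra.
Qed.

(** * Hausdorff content and the gauge *)

(** The content uses infinite sequences of discs of positive radius, so the finite cover is padded
    with tiny discs of total gauge at most [e], available since [f] tends to 0 at 0. *)
Lemma hausdorff_content_le_finite_cover (R : realType) (f : R -> R)
    (l : seq (R[i] * R)) (E : set R[i]) (e : R) :
  gauge_function f -> 0 < e -> (forall p, p \in l -> 0 < p.2) ->
  (forall z, E z -> exists2 p, p \in l & normc (z - p.1) < p.2) ->
  (hausdorff_content f E <= (\sum_(p <- l) f (2 * p.2) + e)%:E)%E.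
Proof.
move=> [f0 _ _ f_cvg0] e0 l0 El.
have small_disc j : exists rho : R, 0 < rho /\ f (2 * rho) <= e / (2 ^ j.+1)%:R.
  have ej : 0 < e / (2 ^ j.+1)%:R by rewrite divr_gt0 // ltr0n expn_gt0.
  have near_f : \forall t \near (0:R)^'+, f t < e / (2 ^ j.+1)%:R.
    exact: (cvgr_lt _ f_cvg0).
  have [t [t0 ft]] : exists t : R, 0 < t /\ f t < e / (2 ^ j.+1)%:R.
    near (0:R)^'+ => t; exists t; split; near: t => //.
    exact: nbhs_right_gt.
  exists (t / 2); split; first by rewrite divr_gt0.
  by rewrite mulrC divfK ?ltW // pnatr_eq0.
have [rho rhoP] := choice small_disc.
pose d : R[i] * R := (0, 0).
pose r j := if (j < size l)%N then (nth d l j).2 else rho j.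
pose g j := if (j < size l)%N then f (2 * (nth d l j).2) else 0.
have g0 j : 0 <= g j.
  by rewrite /g; case: ifP => // jl; rewrite f0 // mulr_gt0 // l0 // mem_nth.
have gr j : f (2 * r j) <= g j + e / (2 ^ j.+1)%:R.
  rewrite /g /r; case: ifP => jl; last by rewrite add0r; case: (rhoP j).
  by rewrite lerDl divr_ge0 // ltW.
have r0 j : 0 < r j.
  by rewrite /r; case: ifP => jl; [rewrite l0 // mem_nth|case: (rhoP j)].
apply: (@le_trans _ _ (\sum_(0 <= j <oo) (f (2 * r j))%:E)%E).
  apply: ereal_inf_lbound; exists (fun j => (nth d l j).1), r; split=> //.
  move=> z /El[p pl zp]; exists (index p l) => //.
  by rewrite /open_disc /= /r index_mem pl nth_index.
apply: (@le_trans _ _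
  (\sum_(0 <= j <oo) ((g j)%:E + (e / (2 ^ j.+1)%:R)%:E))%E).
  apply: lee_nneseries => j _; first by rewrite lee_fin f0 // mulr_gt0.
  by rewrite -EFinD lee_fin.
apply: le_trans (epsilon_trick xpredT _ (ltW e0)) _ => [j|]; first by rewrite lee_fin.
rewrite EFinD leeD2r // (nneseries_split 0 (size l)); last first.
  by move=> j _; rewrite lee_fin.
rewrite add0n eseries0 ?adde0; last first.
  by move=> j lj _; rewrite /g ltnNge lj.
rewrite sumEFin lee_fin (big_nth d) !big_mkord.
by apply: ler_sum => j _; rewrite /g ltn_ord.
Unshelve. all: end_near. Qed.

Lemma h_alpha_le1 (R : realType) (alpha : R) (h : R -> R) (t : R) :
  is_h_alpha alpha h -> 0 < t -> h t <= 1.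
Proof.
move=> [[_ h_incr _ _] _ h1] t0; rewrite leNgt; apply/negP => ht.
have near_h : \forall s \near +oo, h s < h t by exact: (cvgr_lt _ h1).
have [s [ts hs]] : exists s, t < s /\ h s < h t.
  near (pinfty_nbhs R) => s; exists s; split; near: s => //.
  by apply: nbhs_pinfty_gt; exact: num_real.
by have := h_incr _ _ t0 ts; rewrite ltNge (ltW hs).
Unshelve. all: end_near. Qed.

(** * Choice of the radii *)

Lemma sum_inv_pow32_le3 (R : realType) (n : nat) :
  \sum_(k < n) (k.+1%:R * Num.sqrt k.+1%:R)^-1 <= 3 :> R.
Proof.
case: n => [|n]; first by rewrite big_ord0.
(* The subtracted term is the integral of [x^(-3/2)] over the tail; it makes the induction close. *)
suff : \sum_(k < n.+1) (k.+1%:R * Num.sqrt k.+1%:R)^-1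
    <= 3 - 2 / Num.sqrt n.+1%:R :> R.
  by move/le_trans; apply; rewrite gerBl divr_ge0 // sqrtr_ge0.
elim: n => [|n IHn]; first by rewrite big_ord1 sqrtr1 mulr1 invr1; lra.
rewrite big_ord_recr /=; apply: (le_trans (lerD IHn (lexx _))).
set a := Num.sqrt n.+1%:R; set b := Num.sqrt n.+2%:R.
have a0 : 0 < a by rewrite sqrtr_gt0 ltr0n.
have b0 : 0 < b by rewrite sqrtr_gt0 ltr0n.
have a2 : a ^+ 2 = n.+1%:R by rewrite sqr_sqrtr // ler0n.
have b2 : b ^+ 2 = n.+2%:R by rewrite sqr_sqrtr // ler0n.
have ab2 : b ^+ 2 = a ^+ 2 + 1 by rewrite a2 b2 -natr1.
have ab : a <= b by rewrite ler_sqrt ?ler_nat // ltr0n.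
rewrite -b2 -subr_ge0.
have -> : 3 - 2 / b - (3 - 2 / a + (b ^+ 2 * b)^-1) =
    (2 * b ^+ 2 * (b - a) - a) / (a * b ^+ 3).
  by field; rewrite !gt_eqF.
apply: divr_ge0; last by rewrite mulr_ge0 ?exprn_ge0 // ltW.
have dab : (b - a) * (b + a) = 1 by rewrite -subr_sqr ab2; ring.
have -> : 2 * b ^+ 2 * (b - a) - a = (b - a) ^+ 2 * (2 * b + a).
  transitivity (2 * b ^+ 2 * (b - a) - a * ((b - a) * (b + a))); last by ring.
  by rewrite dab mulr1.
by rewrite mulr_ge0 ?sqr_ge0 // addr_ge0 ?mulr_ge0 // ltW.
Qed.

(** This is [x <= exp x] at [x = d L / p], raised to the power [p]. *)
Lemma powR_le_expR (R : realType) (p d L : R) :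
  0 < p -> 0 < d -> 0 <= L -> L `^ p <= (p / d) `^ p * expR (d * L).
Proof.
move=> p0 d0 L0.
have dp0 : 0 < d / p by rewrite divr_gt0.
have L_le : d / p * L <= expR (d / p * L).
  by apply: le_trans (expR_ge1Dx _); rewrite lerDr.
have x0 : 0 <= d / p * L by rewrite mulr_ge0 // ltW.
have -> : L `^ p = (p / d) `^ p * (d / p * L) `^ p.
  rewrite -powRM // ?divr_ge0 ?ltW //; congr (_ `^ _).
  by field; rewrite !gt_eqF.
rewrite ler_wpM2l ?powR_ge0 //.
apply: (@le_trans _ _ (expR (d / p * L) `^ p)).
  by rewrite ge0_ler_powR ?nnegrE ?expR_ge0 // ltW.
rewrite /powR gt_eqF ?expR_gt0 // expRK.
have -> : p * (d / p * L) = d * L by field; rewrite gt_eqF.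
by [].
Qed.

(* The exponent [s_(k+1)]: [k] counts from [0].  Any power of [k+1] in [(1, 2)] would do: above [1]
   the sum converges, below [2] the exponent stays at least a power of [n] for all [k < n]. *)
Definition radius_exponent {R : realType} (alpha A M : R) (n k : nat) : R :=
  A * M ^+ 2 * ln (n%:R + expR 1) `^ (- (2 * alpha / 3))
  / (k.+1%:R * Num.sqrt k.+1%:R).

(** With [L = ln (n + e)] and [s] the exponent, squaring reduces the claim to
    [s (ln s)^(2 alpha) >= M^2 / (k+1)^2]. Since [s] is at least a power of [n + e],
    [ln s >= L / 4], and the gained [L^(2 alpha)] outweighs the [L^(- 2 alpha / 3)] in [s]. *)
Lemma h_alpha_radius_exponent (R : realType) (alpha : R) (alpha_gt0 : 0 < alpha) :
  exists2 A : R, 0 < A &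
    forall h, is_h_alpha alpha h ->
    forall (M : R) (n k : nat), (k < n)%N -> n%:R <= M ->
      h (expR (- radius_exponent alpha A M n k)) <= k.+1%:R / M.
Proof.
pose p := 2 * alpha / 3; have p0 : 0 < p by rewrite /p; lra.
pose B := (p / 4^-1) `^ p; have B0 : 0 < B.
  by rewrite powR_gt0 // divr_gt0 // invr_gt0.
have a0 : 0 < 4 `^ alpha :> R by rewrite powR_gt0.
have A0 : 0 < 9 * B + (4 `^ alpha) ^+ 2 by rewrite addr_gt0 ?exprn_gt0 // mulr_gt0.
(* [9 B] makes [s >= 3 exp(L / 4)]; [(4^alpha)^2] pays for replacing [ln s] by [L / 4]. *)
exists (9 * B + (4 `^ alpha) ^+ 2) => // h [_ hE _] M n k kn nM.
set A := 9 * B + _ in A0 *; rewrite /radius_exponent -/p.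
have n1 : 1 <= n%:R :> R by rewrite ler1n (leq_ltn_trans _ kn).
have M0 : 0 < M by apply: lt_le_trans nM; lra.
pose y : R := n%:R + expR 1; pose L := ln y; rewrite -/y -/L.
have y0 : 0 < y by rewrite addr_gt0 ?expR_gt0 //; lra.
have L1 : 1 <= L.
  by rewrite -(expRK 1) ler_ln ?posrE ?expR_gt0 // lerDr ler0n.
have L0 : 0 < L by lra.
have expL : expR L = y by rewrite lnK.
have y_le : y <= 5 * n%:R.
  have half : 2^-1 <= expR (- 2^-1) :> R by apply: le_trans (expR_ge1Dx _); lra.
  have e4 : expR (1 : R) <= 2 ^+ 2.
    have <- : expR 2^-1 ^+ 2 = expR 1 :> R by rewrite -expRM_natl mulfV.
    rewrite lerXn2r ?nnegrE ?expR_ge0 //.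
    by move: half; rewrite expRN lef_pV2 ?posrE ?expR_gt0.
  by rewrite /y; lra.
have Lp0 : 0 < L `^ p by rewrite powR_gt0.
pose q : R := Num.sqrt k.+1%:R.
have q0 : 0 < q by rewrite sqrtr_gt0 ltr0n.
have q2 : k.+1%:R = q ^+ 2 by rewrite sqr_sqrtr // ler0n.
have q1 : 1 <= q by rewrite -(sqrtr1) ler_sqrt ?ler1n ?ltr0n.
set s := A * _ * _ / _.
have s_def : s = A * M ^+ 2 / (L `^ p * q ^+ 3).
  rewrite /s powRN -/q q2; field; by rewrite !gt_eqF.
have s_ge : 3 * expR (4^-1 * L) <= s.
  pose x := expR (4^-1 * L).
  have x0 : 0 < x by exact: expR_gt0.
  have x2 : x ^+ 4 = y by rewrite -expRM_natl -expL mulrA mulfV ?mul1r.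
  have LpB : L `^ p <= B * x by apply: powR_le_expR => //; lra.
  have q_le : q ^+ 2 <= M by rewrite -q2 (le_trans _ nM) // ler_nat.
  have xM : x ^+ 4 <= 5 * M by rewrite x2; lra.
  rewrite s_def ler_pdivlMr ?mulr_gt0 ?exprn_gt0 // -/x.
  (* After squaring, [x^4 <= 5 M] and [q^2 <= M] give [5 M^4 <= 9 M^4]. *)
  have x2q3 : x ^+ 2 * q ^+ 3 <= 3 * M ^+ 2.
    rewrite -(@ler_pXn2r _ 2) // ?nnegrE ?mulr_ge0 ?exprn_ge0 ?(ltW M0) ?(ltW x0) ?(ltW q0) //.
    have -> : (x ^+ 2 * q ^+ 3) ^+ 2 = x ^+ 4 * (q ^+ 2) ^+ 3 by ring.
    apply: (@le_trans _ _ (5 * M * M ^+ 3)).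
      rewrite ler_pM ?exprn_ge0 ?(ltW x0) ?(ltW q0) //.
      by rewrite lerXn2r ?nnegrE ?exprn_ge0 ?(ltW q0) ?(ltW M0).
    have := exprn_ge0 4 (ltW M0); lra.
  apply: (@le_trans _ _ (3 * B * (x ^+ 2 * q ^+ 3))).
    have -> : 3 * B * (x ^+ 2 * q ^+ 3) = 3 * x * (B * x * q ^+ 3) by ring.
    by rewrite ler_pM2l ?mulr_gt0 // ler_pM2r ?exprn_gt0.
  apply: (@le_trans _ _ (3 * B * (3 * M ^+ 2))); first by rewrite ler_pM2l ?mulr_gt0.
  have -> : 3 * B * (3 * M ^+ 2) = 9 * B * M ^+ 2 by ring.
  by rewrite ler_pM2r ?exprn_gt0 // lerDl sqr_ge0.
have x1 : 1 <= expR (4^-1 * L).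
  by apply: le_trans (expR_ge1Dx _); rewrite lerDl; lra.
have s3 : 3 <= s by lra.
have ln_s : 4^-1 * L <= ln s.
  rewrite -(expRK (4^-1 * L)) ler_ln ?posrE ?expR_gt0 //; lra.
(* [s >= 3] puts [exp(- s)] in the range of the explicit formula for [h]. *)
rewrite hE ?expR_gt0 ?ler_expR ?lerN2 // div1r -expRN opprK expRK.
rewrite !powRN -invfM -[leRHS]invrK invf_div lef_pV2 ?posrE; last 2 first.
- by rewrite mulr_gt0 // powR_gt0; lra.
- by rewrite divr_gt0 // ltr0n.
rewrite div1r powR12_sqrt; last by lra.
have lns_pow : L `^ alpha / 4 `^ alpha <= ln s `^ alpha.
  have -> : L = 4 * (4^-1 * L) by rewrite mulrA mulfV ?mul1r.
  rewrite powRM //; last by lra.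
  rewrite mulrAC mulfV ?mul1r; last by rewrite gt_eqF ?powR_gt0.
  by rewrite ge0_ler_powR ?nnegrE //; lra.
set a := 4 `^ alpha in a0 A A0 s s_def s_ge s3 ln_s lns_pow *; set l := L `^ alpha in lns_pow.
have l0 : 0 < l by rewrite powR_gt0.
have Lpl : L `^ p <= l ^+ 2.
  by rewrite -powR_mulrn ?(ltW l0) // -powRrM ler_powR // /p; lra.
apply: (@le_trans _ _ (Num.sqrt s * (l / a))); last first.
  by rewrite ler_wpM2l ?sqrtr_ge0.
rewrite -(@ler_pXn2r _ 2) // ?nnegrE; last 2 first.
- by rewrite divr_ge0 // ltW.
- by rewrite mulr_ge0 ?sqrtr_ge0 // divr_ge0 // ltW.
rewrite [leRHS]exprMn sqr_sqrtr; last by lra.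
apply: (@le_trans _ _ (M ^+ 2 / q ^+ 3)).
  rewrite expr_div_n ler_pM2l ?exprn_gt0 // lef_pV2 ?posrE ?exprn_gt0 ?ltr0n //.
  by rewrite q2 -exprM ler_weXn2l.
have -> : s * (l / a) ^+ 2 = (A / a ^+ 2) * (l ^+ 2 / L `^ p) * (M ^+ 2 / q ^+ 3).
  by rewrite s_def; field; rewrite !gt_eqF.
rewrite ler_peMl ?divr_ge0 ?exprn_ge0 ?(ltW M0) ?(ltW q0) //.
rewrite mulr_ege1 // ler_pdivlMr ?exprn_gt0 // mul1r //.
by rewrite lerDr mulr_ge0 // ltW.
Qed.

(** * From the radii to the polynomial inequality *)

(** With [d = |z - w|], [1 + |w| <= 2 + d]; then compare with [3 d] for [d >= 1] and [d < 1]
    separately. *)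
Lemma min1_dist_mul_le (R : realType) (z w : R[i]) :
  normc z <= 1 ->
  (1 + normc w) * Num.min 1 (normc (z - w)) <= 3 * normc (z - w).
Proof.
move=> z1; have d0 := @normc_ge0 R (z - w); have w0 := @normc_ge0 R w.
have : normc w <= normc z + normc (z - w).
  have := @normc_triangle R w z 0; rewrite !subr0 addrC.
  by rewrite -[normc (w - z)](normcN (w - z : Rcomplex R)) opprB.
case: (leP 1 (normc (z - w))) => h wz; nra.
Qed.

Lemma radius_exponent_antitone (R : realType) (alpha A M : R) (n : nat) :
  0 <= A ->
  {homo radius_exponent alpha A M n : i j / (i <= j)%N >-> j <= i}.
Proof.
move=> A0 i j ij; rewrite /radius_exponent ler_wpM2l //.
  by rewrite mulr_ge0 ?powR_ge0 // mulr_ge0 ?sqr_ge0.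
rewrite lef_pV2 ?posrE ?mulr_gt0 ?sqrtr_gt0 ?ltr0n //.
by rewrite ler_pM ?sqrtr_ge0 ?ler0n ?ler_sqrt ?ler_nat ?ltr0n.
Qed.

Lemma radius_exponent_ge0 (R : realType) (alpha A M : R) (n k : nat) :
  0 <= A -> 0 <= radius_exponent alpha A M n k.
Proof.
move=> A0; rewrite /radius_exponent divr_ge0 //.
by rewrite mulr_ge0 ?powR_ge0 // mulr_ge0 ?sqr_ge0.
Qed.

Lemma sum_radius_exponent (R : realType) (alpha A M : R) (n : nat) :
  0 <= A ->
  \sum_(k < n) radius_exponent alpha A M n k
    <= 3 * (A * M ^+ 2 * ln (n%:R + expR 1) `^ (- (2 * alpha / 3))).
Proof.
move=> A0; rewrite /radius_exponent -mulr_sumr mulrC ler_wpM2r ?sum_inv_pow32_le3 //.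
by rewrite mulr_ge0 ?powR_ge0 // mulr_ge0 ?sqr_ge0.
Qed.

(** Ensures [M = 2 n / c(Z) >= n]. One disc of radius 2 covers [Z]: gauge at most 1, plus slack
    1. *)
Lemma hausdorff_content_h_alpha_le2 (R : realType) (alpha : R) (h : R -> R)
    (Z : set R[i]) :
  is_h_alpha alpha h -> Z `<=` @closed_unit_disc R ->
  (hausdorff_content h Z <= 2%:E)%E.
Proof.
move=> hh ZD; have gh : gauge_function h by case: hh.
apply: (@le_trans _ _ (\sum_(p <- [:: (0 : R[i], 2 : R)]) h (2 * p.2) + 1)%:E).
  apply: hausdorff_content_le_finite_cover => // [p|z /ZD zD].
    by rewrite inE => /eqP ->.
  exists (0, 2); rewrite ?mem_head //= subr0.
  by apply: le_lt_trans zD _; lra.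
rewrite lee_fin big_seq1 /=.
have := @h_alpha_le1 R alpha h (2 * 2) hh; lra.
Qed.

Lemma cartan_h_alpha (R : realType) (alpha : R) (alpha_gt0 : 0 < alpha) :
  exists2 A : R, 0 < A &
    forall h, is_h_alpha alpha h ->
    forall (Z : set R[i]) (c : R) (s : seq R[i]),
      0 < c <= 2 -> hausdorff_content h Z = c%:E ->
      exists2 z, Z z &
        forall k, (count (fun w => normc (z - w) <
          expR (- radius_exponent alpha A (2 * (size s)%:R / c) (size s) k) / 4)%R
          s <= k)%N.
Proof.
have [A A0 hA] := @h_alpha_radius_exponent R alpha alpha_gt0.
exists A => // h hh Z c s /andP[c0 c2] Zc.
set n := size s; set M := 2 * n%:R / c.
(* Division by 4 gives the exceptional disc of radius [2 r_k] the diameter [exp(- s_k)]. *)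
pose r k := expR (- radius_exponent alpha A M n k) / 4.
have r_mono : {homo r : i j / (i <= j)%N >-> i <= j}.
  move=> i j ij; rewrite /r ler_pM2r ?invr_gt0 // ler_expR lerN2.
  by rewrite radius_exponent_antitone // ltW.
have [l [sum_l lP]] := @cartan_exceptional_discs R r s r_mono.
have [z [Zz zl]] : exists z, Z z /\ forall p, p \in l -> 2 * r p.2 <= normc (z - p.1).
  (* Otherwise the discs cover [Z] with total gauge at most [c / 2]; even with slack [c / 4] this is
     below [c]. *)
  apply: contrapT => no_z.
  have : (hausdorff_content h Z <=
      (\sum_(p <- [seq (p.1, 2 * r p.2) | p <- l]) h (2 * p.2) + c / 4)%:E)%E.
    apply: hausdorff_content_le_finite_cover.
    - by case: hh.
    - by rewrite divr_gt0.
    - by move=> _ /mapP[p _ ->] /=; rewrite mulr_gt0 // divr_gt0 ?expR_gt0.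
    - move=> z Zz; apply: contrapT => zl; apply: no_z; exists z; split=> // p pl.
      rewrite leNgt; apply/negP => zp; apply: zl.
      by exists (p.1, 2 * r p.2) => //; apply/mapP; exists p.
  rewrite Zc lee_fin big_map /=.
  have : \sum_(p <- l) h (2 * (2 * r p.2)) <= \sum_(p <- l) p.2.+1%:R / M.
    rewrite big_seq [leRHS]big_seq; apply: ler_sum => p pl.
    have -> : 2 * (2 * r p.2) = expR (- radius_exponent alpha A M n p.2).
      by rewrite /r; field.
    apply: hA => //.
      (* [p.2 + 1] is one term of a sum bounded by [n], so [p.2 < n]. *)
      apply: leq_trans sum_l; rewrite (perm_big _ (perm_to_rem pl)) big_cons.
      exact: leq_addr.
    rewrite /M ler_pdivlMr // mulrC ler_wpM2r //.
  rewrite -mulr_suml -natr_sum.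
  have : (\sum_(p <- l) p.2.+1)%:R / M <= c / 2.
    apply: (@le_trans _ _ (n%:R / M)).
      by rewrite ler_wpM2r ?ler_nat // invr_ge0 divr_ge0 ?mulr_ge0 // ltW.
    have [n0|n0] := posnP n; first by rewrite n0 mul0r divr_ge0 // ltW.
    suff -> : n%:R / M = c / 2 by [].
    by rewrite /M; field; rewrite gt_eqF // pnatr_eq0 -lt0n.
  lra.
by exists z => //; exact: lP.
Qed.

Theorem lemma3p10 (R : realType) (alpha : R) (alpha_gt0 : 0 < alpha) :
  exists C : R, 0 < C /\
    forall h : R -> R, is_h_alpha alpha h ->
    forall (n : nat) (P : {poly R[i]}), size P = n.+1 ->
    forall Z : set R[i], Z `<=` @closed_unit_disc R ->
      (0 < hausdorff_content h Z)%E ->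
      sup [set Normc.normc P.[z] | z in @closed_unit_disc R] <=
        12 ^+ n *
        expR (C * n%:R ^+ 2 * ln (n%:R + expR 1) `^ (- (2 * alpha / 3))
              / fine (hausdorff_content h Z) ^+ 2) *
        sup [set Normc.normc P.[z] | z in Z].
Proof.
have [A A0 hA] := @cartan_h_alpha R alpha alpha_gt0.
(* Here [12 = 3 * 4]: 3 bounds the sum of [k^(-3/2)], and [M^2 = 4 n^2 / c^2]. *)
exists (12 * A); split=> [|h hh n P sizeP Z ZD Z0]; first by rewrite mulr_gt0.
have Z2 := @hausdorff_content_h_alpha_le2 R alpha h Z hh ZD.
have Zfin : hausdorff_content h Z = (fine (hausdorff_content h Z))%:E.
  by rewrite fineK // ge0_fin_numE ?(ltW Z0) // (le_lt_trans Z2) // ltry.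
set c := fine _ in Zfin *.
have c02 : 0 < c <= 2 by rewrite -lte_fin -[c <= 2]lee_fin -Zfin Z0 Z2.
have c0 : 0 < c by case/andP: c02.
have [s Ps] := closed_field_poly_normal P.
have lead0 : lead_coef P != 0 by rewrite lead_coef_eq0 -size_poly_eq0 sizeP.
have size_s : size s = n.
  by move: sizeP; rewrite Ps size_scale // size_prod_XsubC => -[].
have [z Zz zP] := hA h hh Z c s c02 Zfin.
rewrite size_s in zP; set M := 2 * n%:R / c in zP.
have PE u : normc P.[u] = normc (lead_coef P) * \prod_(w <- s) normc (u - w).
  rewrite {1}Ps hornerZ horner_prod Normc.normcM normc_prod.
  by congr (_ * _); apply: eq_bigr => w _; rewrite hornerXsubC.
(* [U] bounds [|P|] on the disc, hence on [Z], so [sup] over [Z] is a genuine upper bound. *)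
pose U := normc (lead_coef P) * \prod_(w <- s) (1 + normc w).
have PU u : @closed_unit_disc R u -> normc P.[u] <= U.
  move=> u1; rewrite PE ler_wpM2l ?normc_ge0 //.
  apply: ler_prod => w _; rewrite normc_ge0 /=.
  have := @normc_triangle R u 0 w; rewrite subr0 sub0r (normcN (w : Rcomplex R)).
  by move/le_trans; apply; rewrite lerD2r.
have U0 : 0 <= U by apply: le_trans (PU z (ZD z Zz)); exact: normc_ge0.
have PzZ : normc P.[z] <= sup [set normc P.[z] | z in Z].
  apply: ub_le_sup; last by exists z.
  by exists U => _ [u Zu <-]; apply/PU/ZD.
(* The base 12 is [3 * 4]: 4 from the radii, 3 from [min1_dist_mul_le]. *)
have U_le : U <= 12 ^+ n *
    expR (\sum_(k < n) radius_exponent alpha A M n k) * normc P.[z].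
  have prod_r : (12 ^+ n * expR (\sum_(k < n) radius_exponent alpha A M n k))^-1
      * 3 ^+ n <= \prod_(w <- s) Num.min 1 (normc (z - w)).
    have -> : \prod_(w <- s) Num.min 1 (normc (z - w)) =
      \prod_(x <- [seq Num.min 1 (normc (z - w)) | w <- s]) x by rewrite big_map.
    apply: le_trans (@prod_ge_of_count R
      (fun k => expR (- radius_exponent alpha A M n k) / 4) _ _ _).
    - rewrite size_map size_s big_split /= -expR_sum sumrN expRN prodr_const card_ord.
      rewrite (_ : 12 = 3 * 4 :> R); last by rewrite -natrM.
      rewrite exprMn exprVn.
      rewrite (_ : (_ * _)^-1 * _ = 
        (expR (\sum_(k < n) radius_exponent alpha A M n k))^-1 / 4 ^+ n) //.
      by field; rewrite !expf_neq0 ?gt_eqF ?expR_gt0.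
    - by move=> k; rewrite divr_ge0 ?expR_ge0.
    - move=> k _; rewrite count_map; apply: leq_trans (zP k).
      (* The radii are at most [1/4], so truncating distances at 1 leaves the counts unchanged. *)
      apply: sub_count => w /=; rewrite gt_min => /orP[|//].
      have : expR (- radius_exponent alpha A M n k) <= 1.
        by rewrite -expR0 ler_expR oppr_le0 radius_exponent_ge0 // ltW.
      lra.
  have pos : 0 < 12 ^+ n * expR (\sum_(k < n) radius_exponent alpha A M n k).
    by rewrite mulr_gt0 ?exprn_gt0 ?expR_gt0.
  rewrite mulrC -ler_pdivrMr // -(@ler_pM2r _ (3 ^+ n)) ?exprn_gt0 //.
  rewrite -mulrA; apply: le_trans (ler_wpM2l U0 prod_r) _.
  rewrite PE /U -!mulrA ler_wpM2l ?normc_ge0 // -big_split /=.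
  have -> : \prod_(w <- s) normc (z - w) * 3 ^+ n = \prod_(w <- s) (3 * normc (z - w)).
    by rewrite big_split /= big_const_seq count_predT size_s iter_mulr_1 mulrC.
  apply: ler_prod => w _; rewrite min1_dist_mul_le ?andbT; last exact: ZD.
  by rewrite mulr_ge0 ?addr_ge0 ?le_min ?ler01 ?normc_ge0.
apply: sup_le_ub.
  by exists (normc P.[0]), 0 => //; rewrite /closed_unit_disc /mkset Normc.normc0.
move=> _ [u uD <-]; apply: le_trans (PU u uD) _; apply: le_trans U_le _.
apply: ler_pM => //; first exact: normc_ge0.
rewrite ler_pM2l ?exprn_gt0 // ler_expR.
apply: le_trans (@sum_radius_exponent R alpha A M n (ltW A0)) _.
rewrite le_eqVlt; apply/orP; left; apply/eqP.
by rewrite /M; field; rewrite gt_eqF.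
Qed.
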